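(* Let $\mathfrak{g}$ be a Leibniz algebra which is a subspace of codimension $1$ in the vector space $E$. Then there are bijections $$\mathrm{ExtdL}(E,\mathfrak{g})\cong\mathcal{H}\mathcal{L}^2_{\mathfrak{g}}(k,\mathfrak{g})\cong(\mathcal{F}_1(\mathfrak{g})/\equiv_1)\sqcup(\mathcal{F}_2(\mathfrak{g})/\equiv_2),$$ where: $\equiv_1$ is the equivalence relation on $\mathcal{F}_1(\mathfrak{g})$ defined by: $(g_0,\alpha,\lambda,D,\Delta)\equiv_1(g_0',\alpha',\lambda',D',\Delta')$ if and only if $\lambda=\lambda'$ and there exists a pair $(q,G)\in k^*\times\mathfrak{g}$ such that for all $g\in\mathfrak{g}$: $$g_0=q^2g_0'+[G,G]+qD'(G)+q\Delta'(G)-q\alpha'G-\lambda'(G)G,$$ $$\alpha=q\alpha'+\lambda'(G),\qquad D(g)=qD'(g)+[G,g]-\lambda'(g)G,\qquad \Delta(g)=q\Delta'(g)+[g,G];$$ $\equiv_2$ is the equivalence relation on $\mathcal{F}_2(\mathfrak{g})$ defined by: $(g_0,\nu,D,\Delta)\equiv_2(g_0',\nu',D',\Delta')$ if and only if $\nu=\nu'$ and there exists a pair $(q,G)\in k^*\times\mathfrak{g}$ such that for all $g\in\mathfrak{g}$: $$g_0=q^2g_0'+[G,G]+qD'(G)+q\Delta'(G),$$ $$D(g)=qD'(g)+[G,g]+\nu'(g)G,\qquad \Delta(g)=q\Delta'(g)+[g,G]-\nu'(g)G.$$ The bijection between $(\mathcal{F}_1(\mathfrak{g})/\equiv_1)\sqcup(\mathcal{F}_2(\mathfrak{g})/\equiv_2)$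 and $\mathrm{ExtdL}(E,\mathfrak{g})$ sends the class of $(g_0,\alpha,\lambda,D,\Delta)$ to $\mathfrak{g}_1(x\,|\,(g_0,\alpha,\lambda,D,\Delta))$ and the class of $(g_0,\nu,D,\Delta)$ to $\mathfrak{g}_2(x\,|\,(g_0,\nu,D,\Delta))$.
   Context: All vector spaces, linear and bilinear maps are over an arbitrary field $k$; $k^*=k\setminus\{0\}$. A Leibniz algebra is a vector space $\mathfrak{g}$ with a bilinear map $[-,-]$ satisfying $[g,[h,l]]=[[g,h],l]-[[g,l],h]$. $\sqcup$ is disjoint union of sets. Fix a complement $V$ of $\mathfrak{g}$ in $E$ with basis $\{x\}$ (so $V\cong k$), and identify $\mathfrak{g}\times V$ with $E$ via $(g,y)\mapsto g+y$. $\mathrm{ExtdL}(E,\mathfrak{g})$: the set of Leibniz algebra structures on $E$ containing $\mathfrak{g}$ (with its given bracket) as a Leibniz subalgebra, modulo the relation: two structures are equivalent if there is a Leibniz algebra isomorphism $\varphi:E\to E$ from the first to the second with $\varphi(g)=g$ for all $g\in\mathfrak{g}$. $\mathcal{F}_1(\mathfrak{g})$ (flag datums of the first kind): all $5$-tuples $(g_0,\alpha,\lambda,D,\Delta)$ with $g_0\in\mathfrak{g}$, $\alpha\in k$, and linear maps $\lambda:\mathfrak{g}\to k$, $D,\Delta:\mathfrak{g}\to\mathfrak{g}$ such that for all $g,h\in\mathfrak{g}$: (F1) $\lambda([g,h])=0$, $\lambda(D(g))+\alpha\lambda(g)=0$, $\lambda(\Delta(g))=0$; (F2) $D(g_0)=-\alpha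 g_0$, $\lambda(g_0)=-\alpha^2$, $\alpha\Delta(g)=-[g,g_0]$; (F3) $[g,\Delta(h)]+[g,D(h)]=-\lambda(h)\Delta(g)$; (F4) $D^2(g)+D(\Delta(g))=-\lambda(g)g_0$; (F5) $D^2(g)+\Delta(D(g))=\alpha D(g)+[g_0,g]-2\lambda(g)g_0$; (F6) $\Delta([g,h])=[\Delta(g),h]+[g,\Delta(h)]$; (F7) $D([g,h])=[D(g),h]-[D(h),g]+\lambda(g)D(h)-\lambda(h)D(g)$. $\mathcal{F}_2(\mathfrak{g})$ (flag datums of the second kind): all quadruples $(g_0,\nu,D,\Delta)$ with $g_0\in\mathfrak{g}$, $\nu:\mathfrak{g}\to k$ a nonzero linear map, and linear maps $D,\Delta:\mathfrak{g}\to\mathfrak{g}$ such that for all $g,h\in\mathfrak{g}$: (G1) $\nu([g,h])=0$, $[g,g_0]=0$, $D(g_0)=0$, $\nu(g_0)=0$; (G2) $[g,\Delta(h)]+[g,D(h)]=0$, $\nu(D(g))+\nu(\Delta(g))=0$; (G3) $D^2(g)+D(\Delta(g))=0$, $D^2(g)+\Delta(D(g))=[g_0,g]+2\nu(g)g_0$; (G4) $\Delta([g,h])=[\Delta(g),h]+[g,\Delta(h)]+\nu(h)\Delta(g)+\nu(g)D(h)$; (G5) $D([g,h])=[D(g),h]-[D(h),g]-\nu(g)D(h)+\nu(h)D(g)$. $\mathfrak{g}_1(x\,|\,(g_0,\alpha,\lambda,D,\Delta))$ is $\mathfrak{g}\times V$ with the bilinear bracket determined by $[(g,0),(h,0)]=([g,h],0)$,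 $[(g,0),(0,x)]=(\Delta(g),0)$, $[(0,x),(0,x)]=(g_0,\alpha x)$, $[(0,x),(g,0)]=(D(g),\lambda(g)x)$. $\mathfrak{g}_2(x\,|\,(g_0,\nu,D,\Delta))$ is $\mathfrak{g}\times V$ with the bilinear bracket determined by $[(g,0),(h,0)]=([g,h],0)$, $[(g,0),(0,x)]=(\Delta(g),\nu(g)x)$, $[(0,x),(0,x)]=(g_0,0)$, $[(0,x),(g,0)]=(D(g),-\nu(g)x)$. Both are viewed as brackets on $E$ (up to equivalence). $\mathcal{H}\mathcal{L}^2_{\mathfrak{g}}(k,\mathfrak{g})$ is the quotient $\mathcal{L}\mathcal{Z}(\mathfrak{g},V)/\equiv$ for $V\cong k$, where $\mathcal{L}\mathcal{Z}(\mathfrak{g},V)$ is the set of Leibniz extending structures: systems $(\triangleleft,\triangleright,\leftharpoonup,\rightharpoonup,f,\{-,-\})$ of bilinear maps $\triangleleft:V\times\mathfrak{g}\to V$, $\triangleright:V\times\mathfrak{g}\to\mathfrak{g}$, $\leftharpoonup:\mathfrak{g}\times V\to\mathfrak{g}$, $\rightharpoonup:\mathfrak{g}\times V\to V$, $f:V\times V\to\mathfrak{g}$, $\{-,-\}:V\times V\to V$ such that $\mathfrak{g}\times V$ with the bracket $[(g,x),(h,y)]=([g,h]+x\triangleright h+g\leftharpoonup y+f(x,y),\ \{x,y\}+x\triangleleft h+g\rightharpoonup y)$ is a Leibniz algebra; and $(\triangleleft,\triangleright,\leftharpoonup,\rightharpoonup,f,\{-,-\})\equiv(\triangleleft',\triangleright',\leftharpoonup',\rightharpoonup',f',\{-,-\}')$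 if there are a linear map $r:V\to\mathfrak{g}$ and a linear automorphism $v$ of $V$ such that for all $g\in\mathfrak{g}$, $x,y\in V$: $x\triangleleft g=v^{-1}(v(x)\triangleleft' g)$; $g\rightharpoonup x=v^{-1}(g\rightharpoonup' v(x))$; $x\triangleright g=[r(x),g]+v(x)\triangleright' g-r(v^{-1}(v(x)\triangleleft' g))$; $g\leftharpoonup x=[g,r(x)]+g\leftharpoonup' v(x)-r(v^{-1}(g\rightharpoonup' v(x)))$; $\{x,y\}=v^{-1}(r(x)\rightharpoonup' v(y)+v(x)\triangleleft' r(y)+\{v(x),v(y)\}')$; $f(x,y)=[r(x),r(y)]+r(x)\leftharpoonup' v(y)+v(x)\triangleright' r(y)+f'(v(x),v(y))-r\bigl(v^{-1}(r(x)\rightharpoonup' v(y)+v(x)\triangleleft' r(y)+\{v(x),v(y)\}')\bigr)$. *)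

(* Defs.v *)
From mathcomp Require Import all_boot all_algebra.
From mathcomp Require Import sesquilinear.
From mathcomp Require Import boolp classical_sets.

Set Implicit Arguments.
Unset Strict Implicit.
Unset Printing Implicit Defensive.

Import GRing.Theory.

Local Open Scope ring_scope.

(* The quotient of an arbitrary (not necessarily decidable) relation, as the
   type of its classes; meaningful when R is an equivalence relation. *)
Definition quotient (T : Type) (R : T -> T -> Prop) : Type :=
  {C : set T | exists t, C = [set u | R t u]%classic}.

Definition cls (T : Type) (R : T -> T -> Prop) (t : T) : quotient R :=
  exist _ [set u | R t u]%classic (ex_intro _ t erefl).
Arguments cls {T} R t.

Definition leibniz_bracket (k : fieldType) (U : lmodType k)
    (br : U -> U -> U) : Prop :=
  bilinear_for *:%R *:%R br /\
  forall u v w, br u (br v w) = br (br u v) w - br (br u w) v.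

Section LinearAlgebra.
Variables (k : fieldType) (E : lmodType k).

(* dim (E / S) = 1: the class of some e0 is a basis of E / S. *)
Definition codim1 (S : {pred E}) : Prop :=
  exists e0 : E, forall e : E, exists! a : k, e - a *: e0 \in S.

Definition complement (S T : {pred E}) : Prop :=
  (forall u, u \in S -> u \in T -> u = 0) /\
  (forall e, exists u v, [/\ u \in S, v \in T & e = u + v]).

Definition basis1 (V : lmodType k) (x : V) : Prop :=
  forall y : V, exists! a : k, y = a *: x.

Definition decomp (S T : {pred E}) (g : subLmodType S) (V : subLmodType T)
  (p : g * V) : E := val p.1 + val p.2.

End LinearAlgebra.

Section ExtdL.
Variables (k : fieldType) (E : lmodType k) (S : {pred E}) (g : subLmodType S).
Variable brg : g -> g -> g.

Record ext_struct : Type := ExtStruct {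
  ext_br :> E -> E -> E;
  ext_leibniz : leibniz_bracket ext_br;
  ext_sub : forall a b : g, ext_br (val a) (val b) = val (brg a b) }.

Definition ext_equiv (s t : ext_struct) : Prop :=
  exists phi : {linear E -> E},
    [/\ bijective phi,
        forall a b, phi (s a b) = t (phi a) (phi b)
      & forall a : g, phi (val a) = val a].

Definition ExtdL : Type := quotient ext_equiv.

End ExtdL.
Arguments ext_equiv {k E S g} brg s t.

Section ExtendingStructures.
Variables (k : fieldType) (g V : lmodType k) (brg : g -> g -> g).

(* Below, tl, tr, hl, hr stand for the left/right triangles and the left/right
   harpoons, f for the cocycle and cb for the curly bracket. *)
Definition unified_bracket (tl : V -> g -> V) (tr : V -> g -> g)
    (hl : g -> V -> g) (hr : g -> V -> V) (f : V -> V -> g) (cb : V -> V -> V)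
    (p q : g * V) : g * V :=
  let: (a, x) := p in let: (b, y) := q in
  (brg a b + tr x b + hl a y + f x y, cb x y + tl x b + hr a y).

Record LZ : Type := MkLZ {
  lz_tl : {bilinear V -> g -> V};
  lz_tr : {bilinear V -> g -> g};
  lz_hl : {bilinear g -> V -> g};
  lz_hr : {bilinear g -> V -> V};
  lz_f : {bilinear V -> V -> g};
  lz_cb : {bilinear V -> V -> V};
  lz_leibniz : leibniz_bracket
    (unified_bracket lz_tl lz_tr lz_hl lz_hr lz_f lz_cb) }.

Definition LZ_equiv (s t : LZ) : Prop :=
  let: MkLZ tl tr hl hr f cb _ := s in
  let: MkLZ tl' tr' hl' hr' f' cb' _ := t in
  exists (r : {linear V -> g}) (v : {linear V -> V}) (vi : V -> V),
  [/\ cancel v vi, cancel vi v &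
  forall (a : g) (x y : V),
  let c := vi (hr' (r x) (v y) + tl' (v x) (r y) + cb' (v x) (v y)) in
  [/\ tl x a = vi (tl' (v x) a) /\ hr a x = vi (hr' a (v x)),
      tr x a = brg (r x) a + tr' (v x) a - r (vi (tl' (v x) a)),
      hl a x = brg a (r x) + hl' a (v x) - r (vi (hr' a (v x))),
      cb x y = c
    & f x y = brg (r x) (r y) + hl' (r x) (v y) + tr' (v x) (r y)
              + f' (v x) (v y) - r c]].

Definition HL2 : Type := quotient LZ_equiv.

End ExtendingStructures.

Section FlagDatums.
Variables (k : fieldType) (g : lmodType k) (brg : g -> g -> g).
Local Notation "[[ a , b ]]" := (brg a b).

Record flag1 : Type := Flag1 {
  f1_g0 : g;
  f1_alpha : k;
  f1_lambda : {scalar g};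
  f1_D : {linear g -> g};
  f1_Delta : {linear g -> g};
  _ : forall a b, f1_lambda [[a, b]] = 0;
  _ : forall a, f1_lambda (f1_D a) + f1_alpha * f1_lambda a = 0;
  _ : forall a, f1_lambda (f1_Delta a) = 0;
  _ : f1_D f1_g0 = - (f1_alpha *: f1_g0);
  _ : f1_lambda f1_g0 = - f1_alpha ^+ 2;
  _ : forall a, f1_alpha *: f1_Delta a = - [[a, f1_g0]];
  _ : forall a b, [[a, f1_Delta b]] + [[a, f1_D b]]
        = - (f1_lambda b *: f1_Delta a);
  _ : forall a, f1_D (f1_D a) + f1_D (f1_Delta a)
        = - (f1_lambda a *: f1_g0);
  _ : forall a, f1_D (f1_D a) + f1_Delta (f1_D a)
        = f1_alpha *: f1_D a + [[f1_g0, a]] - (2%:R * f1_lambda a) *: f1_g0;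
  _ : forall a b, f1_Delta [[a, b]] = [[f1_Delta a, b]] + [[a, f1_Delta b]];
  _ : forall a b, f1_D [[a, b]]
        = [[f1_D a, b]] - [[f1_D b, a]]
          + f1_lambda a *: f1_D b - f1_lambda b *: f1_D a }.

Record flag2 : Type := Flag2 {
  f2_g0 : g;
  f2_nu : {scalar g};
  f2_D : {linear g -> g};
  f2_Delta : {linear g -> g};
  _ : exists a, f2_nu a != 0;
  _ : forall a b, f2_nu [[a, b]] = 0;
  _ : forall a, [[a, f2_g0]] = 0;
  _ : f2_D f2_g0 = 0;
  _ : f2_nu f2_g0 = 0;
  _ : forall a b, [[a, f2_Delta b]] + [[a, f2_D b]] = 0;
  _ : forall a, f2_nu (f2_D a) + f2_nu (f2_Delta a) = 0;
  _ : forall a, f2_D (f2_D a) + f2_D (f2_Delta a) = 0;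
  _ : forall a, f2_D (f2_D a) + f2_Delta (f2_D a)
        = [[f2_g0, a]] + (2%:R * f2_nu a) *: f2_g0;
  _ : forall a b, f2_Delta [[a, b]]
        = [[f2_Delta a, b]] + [[a, f2_Delta b]]
          + f2_nu b *: f2_Delta a + f2_nu a *: f2_D b;
  _ : forall a b, f2_D [[a, b]]
        = [[f2_D a, b]] - [[f2_D b, a]]
          - f2_nu a *: f2_D b + f2_nu b *: f2_D a }.

Definition flag1_equiv (s t : flag1) : Prop :=
  let: Flag1 g0 al la D De _ _ _ _ _ _ _ _ _ _ _ := s in
  let: Flag1 g0' al' la' D' De' _ _ _ _ _ _ _ _ _ _ _ := t in
  la =1 la' /\
  exists (q : k) (G : g), q != 0 /\ forall a : g,
  [/\ g0 = q ^+ 2 *: g0' + [[G, G]] + q *: D' G + q *: De' G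
           - (q * al') *: G - la' G *: G,
      al = q * al' + la' G,
      D a = q *: D' a + [[G, a]] - la' a *: G
    & De a = q *: De' a + [[a, G]]].

Definition flag2_equiv (s t : flag2) : Prop :=
  let: Flag2 g0 nu D De _ _ _ _ _ _ _ _ _ _ _ := s in
  let: Flag2 g0' nu' D' De' _ _ _ _ _ _ _ _ _ _ _ := t in
  nu =1 nu' /\
  exists (q : k) (G : g), q != 0 /\ forall a : g,
  [/\ g0 = q ^+ 2 *: g0' + [[G, G]] + q *: D' G + q *: De' G,
      D a = q *: D' a + [[G, a]] + nu' a *: G
    & De a = q *: De' a + [[a, G]] - nu' a *: G].

(* A bilinear bracket on g * V with V = k x is determined by the four kinds of
   values below: [is_g1 x d B] says that B is the bracket of g_1(x | d), and
   [is_g2 x d B] that it is the bracket of g_2(x | d). *)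
Variables (V : lmodType k) (x : V).

Definition is_g1 (d : flag1) (B : g * V -> g * V -> g * V) : Prop :=
  [/\ bilinear_for *:%R *:%R B,
      forall a b, B (a, 0) (b, 0) = ([[a, b]], 0),
      forall a, B (a, 0) (0, x) = (f1_Delta d a, 0),
      B (0, x) (0, x) = (f1_g0 d, f1_alpha d *: x)
    & forall a, B (0, x) (a, 0) = (f1_D d a, f1_lambda d a *: x)].

Definition is_g2 (d : flag2) (B : g * V -> g * V -> g * V) : Prop :=
  [/\ bilinear_for *:%R *:%R B,
      forall a b, B (a, 0) (b, 0) = ([[a, b]], 0),
      forall a, B (a, 0) (0, x) = (f2_Delta d a, f2_nu d a *: x),
      B (0, x) (0, x) = (f2_g0 d, 0)
    & forall a, B (0, x) (a, 0) = (f2_D d a, - (f2_nu d a *: x))].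

End FlagDatums.
Arguments flag1_equiv {k g} brg s t.
Arguments flag2_equiv {k g} brg s t.

(* The bracket s on E is B, under the identification g * V = E. *)
Definition viewed_on (k : fieldType) (E : lmodType k) (S T : {pred E})
    (g : subLmodType S) (V : subLmodType T)
    (B : g * V -> g * V -> g * V) (s : E -> E -> E) : Prop :=
  forall p q, s (decomp p) (decomp q) = decomp (B p q).

(* Main.v *)
(* Write a bracket on E = g + k x on generators as [a, x] = Delta a + nu(a) x,
   [x, a] = D a + lambda(a) x, [x, x] = g0 + alpha x.  By trilinearity the
   Leibniz identity is a finite list of equations on the datum
   (lambda, nu, D, Delta, g0, alpha), and an isomorphism fixing g has the form
   x |-> q x + G with q != 0.  Since [u, [v, w] + [w, v]] = 0, the x-components
   on (a, x, x) and (a, b, x) give alpha nu = 0 and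
   nu(a) (nu(b) + lambda(b)) = 0: either nu = 0, a flag datum of the first kind,
   or lambda = - nu and alpha = 0, one of the second kind. *)

Require Import Defs.
From HB Require Import structures.
From mathcomp Require Import all_boot all_algebra.
From mathcomp Require Import sesquilinear ring.
From mathcomp Require Import boolp classical_sets.
From Stdlib Require RelationClasses.

Set Implicit Arguments.
Unset Strict Implicit.
Unset Printing Implicit Defensive.

Import GRing.Theory.

Local Open Scope ring_scope.

(** * Linear combinations by reflection *)

Section ModuleTactic.
Variables (k : comPzRingType) (M : lmodType k).

Inductive lexpr : Type :=
  | LAtom of nat | LZero | LAdd of lexpr & lexpr | LOpp of lexpr
  | LScale of k & lexpr.

Fixpoint leval (env : seq M) (e : lexpr) : M :=
  match e with
  | LAtom i => nth 0 env i
  | LZero => 0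
  | LAdd e1 e2 => leval env e1 + leval env e2
  | LOpp e1 => - leval env e1
  | LScale c e1 => c *: leval env e1
  end.

(** The test is [eqn] so that [cbn] evaluates it on concrete indices. *)
Fixpoint lcoef (e : lexpr) (i : nat) : k :=
  match e with
  | LAtom j => if eqn i j then 1 else 0
  | LZero => 0
  | LAdd e1 e2 => lcoef e1 i + lcoef e2 i
  | LOpp e1 => - lcoef e1 i
  | LScale c e1 => c * lcoef e1 i
  end.

Lemma levalE (env : seq M) (e : lexpr) :
  leval env e = \sum_(i < size env) lcoef e i *: env`_i.
Proof.
elim: e => [j||e1 IH1 e2 IH2|e1 IH1|c e1 IH1] /=.
- have [lt_j|le_j] := ltnP j (size env).
    rewrite (bigD1 (Ordinal lt_j)) //= (introT eqnP erefl).
    rewrite scale1r big1 ?addr0 //.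
    move=> i; rewrite -val_eqE /= => /negPf ne_ij.
    by rewrite -[eqn _ _]/(val i == j) ne_ij scale0r.
  rewrite nth_default // big1 // => i _; rewrite -[eqn _ _]/(val i == j).
  by rewrite ltn_eqF ?scale0r // (leq_trans (ltn_ord i)).
- by rewrite big1 // => i _; rewrite scale0r.
- by rewrite IH1 IH2 -big_split; apply: eq_bigr => i _; rewrite scalerDl.
- by rewrite IH1 -sumrN; apply: eq_bigr => i _; rewrite scaleNr.
- by rewrite IH1 scaler_sumr; apply: eq_bigr => i _; rewrite scalerA.
Qed.

(** By [levalE] both sides are combinations of the same atoms, so equal coefficients suffice. The
    [foldr] form computes to one scalar equation per atom. *)
Lemma leval_eq (env : seq M) (e1 e2 : lexpr) :
  foldr (fun i P => lcoef e1 i = lcoef e2 i /\ P) True (iota 0 (size env)) ->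
  leval env e1 = leval env e2.
Proof.
move=> eq12; rewrite !levalE; apply: eq_bigr => i _; congr (_ *: _).
have: nat_of_ord i \in iota 0 (size env) by rewrite mem_iota /=.
elim: (iota _ _) eq12 => //= j s IHs [eq_j eq_s]; rewrite inE.
by case/orP=> [/eqP-> //|]; apply: IHs.
Qed.

(** Derives a goal from a known equation: what remains is a formal identity between the two
    differences, within reach of [lmod] or [ring]. *)
Lemma eq_of_sub (u v u' v' : M) : u' = v' -> u - v = u' - v' -> u = v.
Proof. by move=> ->; rewrite subrr => /subr0_eq. Qed.

End ModuleTactic.

(* Atoms are compared up to conversion, since structure inference may reach the
   same map through different inheritance paths. *)
Ltac lmod_idx env t :=
  lazymatch env with
  | cons ?u ?env' =>
      match constr:(tt) with
      | _ => let _ := match constr:(tt) with _ => unify u t end in constr:(O)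
      | _ => let n := lmod_idx env' t in constr:(S n)
      end
  end.
Ltac lmod_add env t :=
  match constr:(tt) with
  | _ => let _ := lmod_idx env t in env
  | _ => let rec snoc e :=
           lazymatch e with
           | @nil ?M => constr:(@cons M t (@nil M))
           | @cons ?M ?u ?e' => let e'' := snoc e' in constr:(@cons M u e'')
           end in snoc env
  end.
Ltac lmod_env env t :=
  lazymatch t with
  | @GRing.add _ ?a ?b => let env' := lmod_env env a in lmod_env env' b
  | @GRing.opp _ ?a => lmod_env env a
  | @GRing.scale _ _ _ ?a => lmod_env env a
  | @GRing.zero _ => env
  | _ => lmod_add env t
  end.
Ltac lmod_reify k env t :=
  lazymatch t with
  | @GRing.add _ ?a ?b =>
      let a' := lmod_reify k env a in
      let b' := lmod_reify k env b in constr:(LAdd a' b')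
  | @GRing.opp _ ?a => let a' := lmod_reify k env a in constr:(LOpp a')
  | @GRing.scale _ _ ?c ?a =>
      let a' := lmod_reify k env a in constr:(@LScale k c a')
  | @GRing.zero _ => constr:(@LZero k)
  | _ => let n := lmod_idx env t in constr:(@LAtom k n)
  end.
Ltac lmod k :=
  lazymatch goal with
  | |- @eq ?M ?u ?v =>
      let env := lmod_env (@nil M) u in
      let env := lmod_env env v in
      let e1 := lmod_reify k env u in
      let e2 := lmod_reify k env v in
      apply: (@leval_eq k _ env e1 e2); cbn [foldr iota size lcoef eqn];
      repeat (split; [first [ring | by field]|]); exact: I
  end.

(** * Bilinear and linear maps, as predicates and as bundled structures *)

Section Bilinear.
Variables (k : fieldType) (U U' W : lmodType k) (B : U -> U' -> W).
Hypothesis B_bil : bilinear_for *:%R *:%R B.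

Lemma bilinearDl v u1 u2 : B (u1 + u2) v = B u1 v + B u2 v.
Proof. by have /= := (B_bil.1 v) 1 u1 u2; rewrite !scale1r. Qed.

Lemma bilinearDr u v1 v2 : B u (v1 + v2) = B u v1 + B u v2.
Proof. by have /= := (B_bil.2 u) 1 v1 v2; rewrite !scale1r. Qed.

Lemma bilinear0l v : B 0 v = 0.
Proof. by apply: (addrI (B 0 v)); rewrite -bilinearDl !addr0. Qed.

Lemma bilinear0r u : B u 0 = 0.
Proof. by apply: (addrI (B u 0)); rewrite -bilinearDr !addr0. Qed.

Lemma bilinearZl v c u : B (c *: u) v = c *: B u v.
Proof. by have /= := (B_bil.1 v) c u 0; rewrite bilinear0l !addr0. Qed.

Lemma bilinearZr u c v : B u (c *: v) = c *: B u v.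
Proof. by have /= := (B_bil.2 u) c v 0; rewrite bilinear0r !addr0. Qed.

Lemma bilinearNl v u : B (- u) v = - B u v.
Proof. by rewrite -scaleN1r bilinearZl scaleN1r. Qed.

Lemma bilinearNr u v : B u (- v) = - B u v.
Proof. by rewrite -scaleN1r bilinearZr scaleN1r. Qed.

Definition bilinearE :=
  (bilinearDl, bilinearDr, bilinearZl, bilinearZr, bilinearNl, bilinearNr,
   bilinear0l, bilinear0r).

Definition mk_bilinear : {bilinear U -> U' -> W} :=
  HB.pack B (bilinear_isBilinear.Build k U U' W *:%R *:%R B B_bil).

End Bilinear.

Lemma bilinear_map_for (k : fieldType) (U U' W : lmodType k)
    (B : {bilinear U -> U' -> W}) : bilinear_for *:%R *:%R B.
Proof.
split=> [w|w] c u v /=; first by rewrite linearDl linearZl_LR.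
by rewrite linearDr linearZr_LR.
Qed.

Definition bimapE (k : fieldType) (U U' W : lmodType k)
    (B : {bilinear U -> U' -> W}) := bilinearE (bilinear_map_for B).

Definition mk_linear (k : fieldType) (U : lmodType k) (W : lmodType k)
    (f : U -> W) (f_lin : linear f) : {linear U -> W} :=
  HB.pack f (GRing.isLinear.Build k U W *:%R f f_lin).

Definition mk_scalar (k : fieldType) (U : lmodType k)
    (f : U -> k) (f_lin : scalar f) : {scalar U} :=
  HB.pack f (GRing.isLinear.Build k U k *%R f f_lin).

Lemma lin_scale (k : fieldType) (U W : lmodType k) (f : {linear U -> W}) c u :
  f (c *: u) = c *: f u.
Proof. exact: linearZ_LR. Qed.

(* Fixing [f] keeps rewriting from commuting nested scalings forever. *)
Definition linE (k : fieldType) (U W : lmodType k) (f : {linear U -> W}) :=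
  (linearD f, linearN f, linear0 f, lin_scale f).

Definition scalE (k : fieldType) (U : lmodType k) (f : {scalar U}) :=
  (linearD f, linearN f, linear0 f, scalarZ f).

(** * Flag datums of both kinds as one notion *)

Record datum (k : fieldType) (g : lmodType k) : Type := Datum {
  d_la : {scalar g}; d_nu : {scalar g}; d_D : {linear g -> g};
  d_De : {linear g -> g}; d_g0 : g; d_al : k }.

Section DatumTheory.
Variables (k : fieldType) (g : lmodType k) (brg : g -> g -> g).
Hypothesis brg_leibniz : leibniz_bracket brg.

(* The two components of the Leibniz identity on each triple of generators. *)
Definition datum_ok (d : datum g) : Prop :=
  let: Datum la nu D De g0 al := d in
  [/\ forall a b, brg a (De b) + nu b *: De a
        = De (brg a b) - brg (De a) b - nu a *: D b
        /\ nu b * nu a = nu (brg a b) - nu a * la b,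
      forall a b, brg a (D b) + la b *: De a
        = brg (De a) b + nu a *: D b - De (brg a b)
        /\ la b * nu a = nu a * la b - nu (brg a b),
      forall a b, D (brg a b)
        = brg (D a) b + la a *: D b - brg (D b) a - la b *: D a
        /\ la (brg a b) = la a * la b - la b * la a,
      forall a, brg a g0 + al *: De a = 0 /\ al * nu a = 0
    & [/\ forall a, D (De a) + nu a *: g0
            = De (D a) + la a *: g0 - brg g0 a - al *: D a
            /\ la (De a) + nu a * al = nu (D a) + la a * al - al * la a,
          forall a, D (D a) + la a *: g0
            = brg g0 a + al *: D a - De (D a) - la a *: g0
            /\ la (D a) + la a * al = al * la a - nu (D a) - la a * al
        & D g0 + al *: g0 = 0 /\ la g0 + al * al = 0]].

(** The change of datum under a map fixing [g] and sending the extra generator [X] to [G + q X]. The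
    last equation subtracts [al *: G] with the new [al], because [al X] itself maps to
    [al G + al q X]. *)
Definition datum_equiv (d d' : datum g) : Prop :=
  let: Datum la nu D De g0 al := d in
  let: Datum la' nu' D' De' g0' al' := d' in
  exists (q : k) (G : g), [/\ q != 0, la =1 la', nu =1 nu',
    forall a, D a = q *: D' a + brg G a - la' a *: G
            /\ De a = q *: De' a + brg a G - nu' a *: G
    & al = q * al' + la' G + nu' G
      /\ g0 = q ^+ 2 *: g0' + brg G G + q *: D' G + q *: De' G - al *: G].

Lemma datum_equiv_refl d : datum_equiv d d.
Proof.
have bE := bilinearE brg_leibniz.1.
case: d => la nu D De g0 al; exists 1, 0.
split=> //; first exact: oner_neq0.
  by move=> a; rewrite !bE; split; lmod k.
by rewrite !(linear0, bE); split; [ring | lmod k].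
Qed.

(** * The Leibniz identity tested on generators *)

Section Realization.
Variables (U : lmodType k) (i : {linear g -> U}) (X : U).
Hypothesis iX_gen : forall u, exists a c, u = i a + c *: X.

(** The space [U] stays abstract so that the table serves both [E], with [val] and [val x], and
    [g * V], with the pairs [(a, 0)] and [(0, x)]. *)
Definition bracket_table (d : datum g) (B : U -> U -> U) : Prop :=
  [/\ forall a b, B (i a) (i b) = i (brg a b),
      forall a, B (i a) X = i (d_De d a) + d_nu d a *: X,
      forall a, B X (i a) = i (d_D d a) + d_la d a *: X
    & B X X = i (d_g0 d) + d_al d *: X].

Variables (d : datum g) (B : U -> U -> U).
Hypothesis B_bil : bilinear_for *:%R *:%R B.
Hypothesis B_table : bracket_table d B.

Lemma bracketE a b c e :
  B (i a + c *: X) (i b + e *: X) =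
  i (brg a b + c *: d_D d b + e *: d_De d a + (c * e) *: d_g0 d)
  + (c * d_la d b + e * d_nu d a + c * e * d_al d) *: X.
Proof.
have [tab tax txa txx] := B_table.
rewrite !(bilinearE B_bil) tab tax txa txx !(linE i).
by lmod k.
Qed.

Let leibniz_on u v w := B u (B v w) = B (B u v) w - B (B u w) v.

(** The identity is linear in each of its three arguments, so these are extended from generators to
    all of [U] one at a time. *)
Lemma leibniz_on_gen :
  (forall a b e, leibniz_on (i a) (i b) (i e)) ->
  (forall a b, leibniz_on (i a) (i b) X) ->
  (forall a b, leibniz_on (i a) X (i b)) ->
  (forall a b, leibniz_on X (i a) (i b)) ->
  (forall a, leibniz_on (i a) X X) ->
  (forall a, leibniz_on X (i a) X) ->
  (forall a, leibniz_on X X (i a)) ->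
  leibniz_on X X X ->
  forall u v w, leibniz_on u v w.
Proof.
move=> Laaa Laax Laxa Lxaa Laxx Lxax Lxxa Lxxx.
have gen1 v w : (forall a, leibniz_on (i a) v w) -> leibniz_on X v w ->
    forall u, leibniz_on u v w.
  move=> La Lx u; have [a [c ->]] := iX_gen u; rewrite /leibniz_on.
  by rewrite !(bilinearE B_bil) La Lx; lmod k.
have gen2 u w : (forall a, leibniz_on u (i a) w) -> leibniz_on u X w ->
    forall v, leibniz_on u v w.
  move=> La Lx v; have [a [c ->]] := iX_gen v; rewrite /leibniz_on.
  by rewrite !(bilinearE B_bil) La Lx; lmod k.
have gen3 u v : (forall a, leibniz_on u v (i a)) -> leibniz_on u v X ->
    forall w, leibniz_on u v w.
  move=> La Lx w; have [a [c ->]] := iX_gen w; rewrite /leibniz_on.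
  by rewrite !(bilinearE B_bil) La Lx; lmod k.
by move=> u v w; apply: gen1 => [a|]; apply: gen2 => [b|]; apply: gen3 => [e|].
Qed.

Lemma datum_ok_leibniz : datum_ok d -> leibniz_bracket B.
Proof.
(* Glues the two components of an equation of [datum_ok] into one equation in [U]. *)
have iE p c p' c' : p = p' /\ c = c' -> i p + c *: X = i p' + c' *: X.
  by case=> -> ->.
have bE := bilinearE B_bil; case: (B_table).
case: d => la nu D De g0 al /= tab tax txa txx.
have T := (tab, tax, txa, txx).
case=> H1 H2 H3 H4 [H5 H6 H7]; split=> //.
apply: leibniz_on_gen => [a b e|a b|a b|a b|a|a|a|]; rewrite /leibniz_on.
- by rewrite !T brg_leibniz.2 linearB.
- by rewrite !(T, bE); have:= iE _ _ _ _ (H1 a b); rewrite !(linE i) => J;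
    apply: (eq_of_sub J); lmod k.
- by rewrite !(T, bE); have:= iE _ _ _ _ (H2 a b); rewrite !(linE i) => J;
    apply: (eq_of_sub J); lmod k.
- by rewrite !(T, bE); have:= iE _ _ _ _ (H3 a b); rewrite !(linE i) => J;
    apply: (eq_of_sub J); lmod k.
- by rewrite !(T, bE); have:= iE _ _ _ _ (H4 a); rewrite !(linE i) => J;
    apply: (eq_of_sub J); lmod k.
- by rewrite !(T, bE); have:= iE _ _ _ _ (H5 a); rewrite !(linE i) => J;
    apply: (eq_of_sub J); lmod k.
- by rewrite !(T, bE); have:= iE _ _ _ _ (H6 a); rewrite !(linE i) => J;
    apply: (eq_of_sub J); lmod k.
- by rewrite !(T, bE); have:= iE _ _ _ _ H7; rewrite !(linE i) => J;
    apply: (eq_of_sub J); lmod k.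
Qed.

Hypothesis iX_inj : forall p c p' c',
  i p + c *: X = i p' + c' *: X -> p = p' /\ c = c'.

(** The identity on each triple of generators splits into its components along [i] and [X], which
    [iX_inj] separates. *)
Lemma leibniz_datum_ok : leibniz_bracket B -> datum_ok d.
Proof.
case=> _ L; have bE := bilinearE B_bil; case: (B_table).
case: d => la nu D De g0 al /= tab tax txa txx.
have T := (tab, tax, txa, txx).
split; last split; [move=> a b|move=> a b|move=> a b|move=> a|
  move=> a|move=> a|]; apply: iX_inj; rewrite !(linE i) ?scale0r.
- by have J := L (i a) (i b) X; rewrite !(T, bE) in J;
    apply: (eq_of_sub J); lmod k.
- by have J := L (i a) X (i b); rewrite !(T, bE) in J;
    apply: (eq_of_sub J); lmod k.
- by have J := L X (i a) (i b); rewrite !(T, bE) in J;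
    apply: (eq_of_sub J); lmod k.
- by have J := L (i a) X X; rewrite !(T, bE) in J;
    apply: (eq_of_sub J); lmod k.
- by have J := L X (i a) X; rewrite !(T, bE) in J;
    apply: (eq_of_sub J); lmod k.
- by have J := L X X (i a); rewrite !(T, bE) in J;
    apply: (eq_of_sub J); lmod k.
- by have J := L X X X; rewrite !(T, bE) in J;
    apply: (eq_of_sub J); lmod k.
Qed.

End Realization.
End DatumTheory.

(** * Extensions and extending structures read on generators *)

Lemma basis1_free (k : fieldType) (V : lmodType k) (x : V) :
  basis1 x -> injective (fun a : k => a *: x).
Proof.
move=> x_basis a b /= eq_ab; have [c [_ c_uniq]] := x_basis (a *: x).
by rewrite -(c_uniq a) // -(c_uniq b).
Qed.

Lemma basis1_coord (k : fieldType) (V : lmodType k) (x : V) :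
  basis1 x -> exists c : {scalar V}, forall y, y = c y *: x.
Proof.
move=> x_basis; have coordP y : {a | y = a *: x}.
  by apply: cid; have [a [y_ax _]] := x_basis y; exists a.
have c_lin : scalar (fun y => sval (coordP y)).
  move=> a y z; apply: (basis1_free x_basis) => /=.
  by rewrite scalerDl -scalerA -!(svalP (coordP _)).
by exists (mk_scalar c_lin) => y; apply: (svalP (coordP y)).
Qed.

(** * The identification of [g * V] with [E] *)

Section Decomposition.
Variables (k : fieldType) (E : lmodType k) (S T : {pred E}).
Variables (g : subLmodType S) (V : subLmodType T).

Lemma decomp_linear : linear (@decomp k E S T g V).
Proof.
by move=> c [a y] [b z]; rewrite /decomp /= !(linE \val); lmod k.
Qed.

Lemma decomp_inverse : complement S T ->
  exists P : {linear E -> (g * V)%type},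
    cancel P (@decomp k E S T g V) /\ cancel (@decomp k E S T g V) P.
Proof.
case=> ST0 STE; have decomp_inj : injective (@decomp k E S T g V).
  move=> [a y] [b z]; rewrite /decomp /= => eq_ab.
  (* This common value lies in both [S] and [T], hence vanishes. *)
  have sub_ab : \val (a - b) = \val (z - y) :> E.
    by apply: (eq_of_sub eq_ab); rewrite !(linE \val); lmod k.
  have val0 : \val (a - b) = 0 :> E.
    by apply: ST0; [apply: valP | rewrite sub_ab; apply: valP].
  have ->: a = b by apply: subr0_eq; apply: val_inj; rewrite val0 linear0.
  have ->//: y = z.
  by symmetry; apply: subr0_eq; apply: val_inj; rewrite -sub_ab val0 linear0.
have PP e : {p | e = @decomp k E S T g V p}.
  apply: cid; have [u [v [uS vT ->]]] := STE e.
  by exists (Sub u uS, Sub v vT); rewrite /decomp /= !SubK.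
have P_lin : linear (fun e => sval (PP e)).
  move=> c e f; apply: decomp_inj; rewrite decomp_linear.
  by rewrite -!(svalP (PP _)).
exists (mk_linear P_lin); split=> [e|p] /=; first by rewrite -(svalP (PP e)).
by apply: decomp_inj; rewrite -(svalP (PP _)).
Qed.

End Decomposition.

Lemma pair_linear (k : fieldType) (g V : lmodType k) :
  linear (fun a : g => (a, 0 : V)).
Proof.
by move=> c a b; rewrite -[RHS]/(c *: a + b, c *: 0 + 0) scaler0 addr0.
Qed.

Section Extensions.
Variables (k : fieldType) (E : lmodType k) (S T : {pred E}).
Variables (g : subLmodType S) (V : subLmodType T) (brg : g -> g -> g) (x : V).
Variables (P : {linear E -> (g * V)%type}) (coord : {scalar V}).
Hypothesis brg_leibniz : leibniz_bracket brg.
Hypothesis PK : cancel P (@decomp k E S T g V).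
Hypothesis decompK : cancel (@decomp k E S T g V) P.
Hypothesis coordE : forall y, y = coord y *: x.
Hypothesis x_free : injective (fun a : k => a *: x).

Let i : {linear g -> E} := \val.
Let X : E := \val x.
Let j : {linear g -> (g * V)%type} := mk_linear (@pair_linear k g V).
Let Y : g * V := (0, x).

Lemma coordZ c : coord (c *: x) = c.
Proof. by apply: x_free => /=; rewrite -coordE. Qed.

Lemma jY_pair a c : (a, c *: x) = j a + c *: Y.
Proof. by rewrite -[RHS]/(a + c *: 0, 0 + c *: x) scaler0 addr0 add0r. Qed.

Lemma jY_gen p : exists a c, p = j a + c *: Y.
Proof. by case: p => a y; exists a, (coord y); rewrite -jY_pair -coordE. Qed.

Lemma decomp_jY a c : decomp (j a + c *: Y) = i a + c *: X.
Proof. by rewrite -jY_pair /decomp /= lin_scale. Qed.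

Lemma P_iX a c : P (i a + c *: X) = (a, c *: x).
Proof. by rewrite -decomp_jY -jY_pair decompK. Qed.

Lemma P_i a : P (i a) = (a, 0).
Proof. by rewrite -[RHS]decompK /decomp /= linear0 addr0. Qed.

Lemma P_X : P X = (0, x).
Proof. by rewrite -[RHS]decompK /decomp /= linear0 add0r. Qed.

Lemma iX_gen e : exists a c, e = i a + c *: X.
Proof.
have [a [c P_e]] := jY_gen (P e); exists a, c.
by rewrite -decomp_jY -P_e PK.
Qed.

Lemma iX_inj a c a' c' : i a + c *: X = i a' + c' *: X -> a = a' /\ c = c'.
Proof. by move/(congr1 P); rewrite !P_iX => -[-> /x_free->]. Qed.

(** The datum is read off by splitting the brackets of generators with [P] and [coord]. *)
Lemma ext_table (s : ext_struct brg) :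
  exists2 d, bracket_table brg i X d s & datum_ok brg d.
Proof.
have s_bil := (ext_leibniz s).1.
have la_lin : scalar (fun a => coord (P (s X (i a))).2).
  by move=> c a b; rewrite !(linE i) !(bilinearE s_bil) linearP /= linearP.
have nu_lin : scalar (fun a => coord (P (s (i a) X)).2).
  by move=> c a b; rewrite !(linE i) !(bilinearE s_bil) linearP /= linearP.
have D_lin : linear (fun a => (P (s X (i a))).1).
  by move=> c a b; rewrite !(linE i) !(bilinearE s_bil) linearP.
have De_lin : linear (fun a => (P (s (i a) X)).1).
  by move=> c a b; rewrite !(linE i) !(bilinearE s_bil) linearP.
pose d := Datum (mk_scalar la_lin) (mk_scalar nu_lin) (mk_linear D_lin)
  (mk_linear De_lin) (P (s X X)).1 (coord (P (s X X)).2).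
have eE e : e = i (P e).1 + coord (P e).2 *: X.
  by rewrite -decomp_jY -jY_pair -coordE -surjective_pairing PK.
have s_table : bracket_table brg i X d s.
  by split=> [a b|a|a|]; rewrite -?eE //; apply: ext_sub.
by exists d => //; apply: leibniz_datum_ok s_bil s_table iX_inj (ext_leibniz s).
Qed.

Definition LZ_bracket (s : LZ V brg) : g * V -> g * V -> g * V :=
  unified_bracket brg (lz_tl s) (lz_tr s) (lz_hl s) (lz_hr s)
    (lz_f s) (lz_cb s).

Lemma LZ_ext_leibniz (s : LZ V brg) :
  leibniz_bracket (fun e f => decomp (LZ_bracket s (P e) (P f))).
Proof.
have [s_bil s_leib] : leibniz_bracket (LZ_bracket s) by apply: lz_leibniz.
split=> [|u v w]; last first.
  rewrite !decompK s_leib.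
  by rewrite (zmod_morphism_linear (@decomp_linear _ _ _ _ _ _)).
by split=> [f|e] c u v /=; rewrite linearP !(bilinearE s_bil) decomp_linear.
Qed.

Lemma LZ_ext_sub (s : LZ V brg) (a b : g) :
  decomp (LZ_bracket s (P (val a)) (P (val b))) = val (brg a b).
Proof.
rewrite !P_i /LZ_bracket /=.
rewrite !(linear0l, linear0r) !addr0.
by rewrite /decomp /= linear0 addr0.
Qed.

Definition LZ_ext (s : LZ V brg) : ext_struct brg :=
  ExtStruct (LZ_ext_leibniz s) (LZ_ext_sub s).

Lemma LZ_ext_viewed (s : LZ V brg) : viewed_on (LZ_bracket s) (LZ_ext s).
Proof. by move=> p q; rewrite /LZ_ext /= !decompK. Qed.

(** The values at the basis vector [x] determine the six bilinear maps, so this is the datum of an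
    extending structure. *)
Definition LZ_table (d : datum g) (s : LZ V brg) : Prop :=
  [/\ forall a, lz_tl s x a = d_la d a *: x /\ lz_hr s a x = d_nu d a *: x,
      forall a, lz_tr s x a = d_D d a /\ lz_hl s a x = d_De d a,
      lz_f s x x = d_g0 d
    & lz_cb s x x = d_al d *: x].

Lemma LZ_ext_table d s :
  LZ_table d s <-> bracket_table brg i X d (LZ_ext s).
Proof.
have brg0 := (bilinear0l brg_leibniz.1, bilinear0r brg_leibniz.1).
have dE a y : decomp (a, y) = i a + coord y *: X.
  by rewrite {1}[y]coordE jY_pair decomp_jY.
(* On a pair of generators, every term of the unified bracket with a zero argument dies, leaving one
   map in each component. *)
have ax a : LZ_ext s (i a) X = i (lz_hl s a x) + coord (lz_hr s a x) *: X.
  rewrite /= P_i P_X /LZ_bracket /= dE.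
  by rewrite !(brg0, linear0l, linear0r) ?add0r ?addr0.
have xa a : LZ_ext s X (i a) = i (lz_tr s x a) + coord (lz_tl s x a) *: X.
  rewrite /= P_i P_X /LZ_bracket /= dE.
  by rewrite !(brg0, linear0l, linear0r) ?add0r ?addr0.
have xx : LZ_ext s X X = i (lz_f s x x) + coord (lz_cb s x x) *: X.
  by rewrite /= P_X /LZ_bracket /= dE !(brg0, linear0l, linear0r) ?add0r ?addr0.
split=> [[Tl Tr Tf Tc]|[Taa Tax Txa Txx]].
- split=> [a b|a|a|]; first exact: LZ_ext_sub.
  + by rewrite ax (Tl a).2 (Tr a).2 coordZ.
  + by rewrite xa (Tl a).1 (Tr a).1 coordZ.
  + by rewrite xx Tf Tc coordZ.
- have {ax}Tax a : lz_hl s a x = d_De d a /\ coord (lz_hr s a x) = d_nu d a.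
    by apply: iX_inj; rewrite -ax Tax.
  have {xa}Txa a : lz_tr s x a = d_D d a /\ coord (lz_tl s x a) = d_la d a.
    by apply: iX_inj; rewrite -xa Txa.
  have {xx}[Tf Tc] : lz_f s x x = d_g0 d /\ coord (lz_cb s x x) = d_al d.
    by apply: iX_inj; rewrite -xx Txx.
  split=> [a|a||]; rewrite ?(Txa a).1 ?(Tax a).1 //.
  + by rewrite -(Txa a).2 -(Tax a).2 -!coordE.
  + by rewrite -Tc -coordE.
Qed.

Lemma LZ_bracket_gens d s : LZ_table d s ->
  [/\ bilinear_for *:%R *:%R (LZ_bracket s),
      forall a b, LZ_bracket s (a, 0) (b, 0) = (brg a b, 0),
      forall a, LZ_bracket s (a, 0) (0, x) = (d_De d a, d_nu d a *: x),
      LZ_bracket s (0, x) (0, x) = (d_g0 d, d_al d *: x)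
    & forall a, LZ_bracket s (0, x) (a, 0) = (d_D d a, d_la d a *: x)].
Proof.
have brg0 := (bilinear0l brg_leibniz.1, bilinear0r brg_leibniz.1).
case=> Tl Tr Tf Tc.
split=> [|a b|a||a]; first exact: (lz_leibniz s).1.
- by rewrite /LZ_bracket /= !(brg0, linear0l, linear0r) ?addr0.
- by rewrite /LZ_bracket /= !(brg0, linear0l, linear0r) ?add0r ?addr0
    (Tl a).2 (Tr a).2.
- by rewrite /LZ_bracket /= !(brg0, linear0l, linear0r) ?add0r ?addr0 Tf Tc.
- by rewrite /LZ_bracket /= !(brg0, linear0l, linear0r) ?add0r ?addr0
    (Tl a).1 (Tr a).1.
Qed.

(** The six maps extend the prescribed values at [x] bilinearly through [coord]; their unified
    bracket has table [d], so [datum_ok_leibniz] applies in [g * V]. *)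
Lemma LZ_of_datum (d : datum g) : datum_ok brg d -> exists s, LZ_table d s.
Proof.
move=> d_ok.
have tl_bil : bilinear_for *:%R *:%R (fun (y : V) a => d_la d a *: y).
  by split=> w c u v /=; rewrite ?(scalE (d_la d)); lmod k.
have tr_bil : bilinear_for *:%R *:%R (fun (y : V) a => coord y *: d_D d a).
  by split=> w c u v /=; rewrite ?(scalE coord, linE (d_D d)); lmod k.
have hl_bil : bilinear_for *:%R *:%R (fun a (y : V) => coord y *: d_De d a).
  by split=> w c u v /=; rewrite ?(scalE coord, linE (d_De d)); lmod k.
have hr_bil : bilinear_for *:%R *:%R (fun a (y : V) => d_nu d a *: y).
  by split=> w c u v /=; rewrite ?(scalE (d_nu d)); lmod k.
have f_bil : bilinear_for *:%R *:%R
    (fun y z : V => (coord y * coord z) *: d_g0 d).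
  by split=> w c u v /=; rewrite ?(scalE coord); lmod k.
have cb_bil : bilinear_for *:%R *:%R (fun y z : V => (coord y * d_al d) *: z).
  by split=> w c u v /=; rewrite ?(scalE coord); lmod k.
have brgD := bilinearE brg_leibniz.1.
pose B := unified_bracket brg (mk_bilinear tl_bil) (mk_bilinear tr_bil)
  (mk_bilinear hl_bil) (mk_bilinear hr_bil) (mk_bilinear f_bil)
  (mk_bilinear cb_bil).
have coordx : coord x = 1 by rewrite -[x]scale1r coordZ.
have B_bil : bilinear_for *:%R *:%R B.
  by split=> [[e w]|[e w]] c [a y] [b z];
    rewrite /B /= !brgD;
    apply: (congr2 pair) => /=;
    rewrite ?(scalE coord, scalE (d_la d), scalE (d_nu d), linE (d_D d),
              linE (d_De d)); lmod k.
have B_table : bracket_table brg j Y d B.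
  have jE a : j a = (a, 0) by [].
  by split=> [a b|a|a|]; rewrite -?jY_pair ?jE /B /=;
    rewrite !(brgD, linear0, coordx, scale0r, scaler0, mul0r, mulr0, mul1r,
              scale1r, add0r, addr0).
have B_leib : leibniz_bracket B :=
  datum_ok_leibniz brg_leibniz jY_gen B_bil B_table d_ok.
exists (MkLZ B_leib); split=> [a|a||] //=; rewrite coordx ?scale1r //.
  by rewrite mul1r scale1r.
by rewrite mul1r.
Qed.

(** An isomorphism fixing [g] is determined by the image [i G + q *: X] of [X]; compatibility with
    the brackets need only be compared on generators. *)
Lemma ext_equivP (s t : ext_struct brg) d d' :
  bracket_table brg i X d s -> bracket_table brg i X d' t ->
  ext_equiv brg s t <-> datum_equiv brg d d'.
Proof.
move=> s_tab t_tab.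
have sE := bracketE (ext_leibniz s).1 s_tab.
have tE := bracketE (ext_leibniz t).1 t_tab.
have brgE := bilinearE brg_leibniz.1.
have i_eq a c b e : a = b -> c = e -> i a + c *: X = i b + e *: X.
  by move=> -> ->.
case: s_tab t_tab; case: d sE => la nu D De g0 al /= sE.
case: d' tE => la' nu' D' De' g0' al' /= tE saa sax sxa sxx [taa tax txa txx].
have eq_i a : i a = i a + 0 *: X by rewrite scale0r addr0.
have eq_X : X = i 0 + 1 *: X by rewrite linear0 scale1r add0r.
split=> [[phi [phi_bij phiM phi_i]]|[q [G [q0 la_eq nu_eq eqD [eq_al eq_g0]]]]].
  have [G [q phi_X]] := iX_gen (phi X); exists q, G.
  have phiE a c : phi (i a + c *: X) = i (a + c *: G) + (c * q) *: X.
    by rewrite !(linE phi) phi_i phi_X !(linE i); lmod k.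
  (* If [q] were zero, [X] and [i G] would have the same image under the injective [phi]. *)
  have q0 : q != 0.
    apply/eqP => q0; have: i 0 + 1 *: X = i G + 0 *: X.
      rewrite -eq_X -eq_i; apply: (bij_inj phi_bij).
      by rewrite phi_X phi_i q0 scale0r addr0.
    by case/iX_inj=> _ /eqP; rewrite oner_eq0.
  (* Apply [phi] to a table entry of [s], expand the result by the table of [t], and compare
     components; the nonzero factor [q] is cancelled afterwards. *)
  have ax a : De a + nu a *: G = brg a G + q *: De' a /\ nu a * q = q * nu' a.
    apply: iX_inj; rewrite -phiE -sax phiM phi_i phi_X {1}[i a]eq_i tE.
    by apply: i_eq; [lmod k | ring].
  have xa a : D a + la a *: G = brg G a + q *: D' a /\ la a * q = q * la' a.
    apply: iX_inj; rewrite -phiE -sxa phiM phi_i phi_X {1}[i a]eq_i tE.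
    by apply: i_eq; [lmod k | ring].
  have [xx1 xx2] : g0 + al *: G
      = brg G G + q *: D' G + q *: De' G + (q * q) *: g0'
      /\ al * q = q * la' G + q * nu' G + q * q * al'.
    by apply: iX_inj; rewrite -phiE -sxx phiM phi_X tE.
  have la_eq a : la a = la' a by apply: (mulIf q0); rewrite (xa a).2 mulrC.
  have nu_eq a : nu a = nu' a by apply: (mulIf q0); rewrite (ax a).2 mulrC.
  split=> // [a|].
    rewrite -la_eq -nu_eq; split.
      by apply: (eq_of_sub (xa a).1); lmod k.
    by apply: (eq_of_sub (ax a).1); lmod k.
  split; last by apply: (eq_of_sub xx1); lmod k.
  by apply: (mulIf q0); rewrite xx2; ring.
pose pg e : g := (P e).1; pose pk e := coord (P e).2.
have pg_iX a c : pg (i a + c *: X) = a by rewrite /pg P_iX.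
have pk_iX a c : pk (i a + c *: X) = c by rewrite /pk P_iX coordZ.
have eE e : e = i (pg e) + pk e *: X.
  by have [a [c ->]] := iX_gen e; rewrite pg_iX pk_iX.
(* The linear map fixing [g] and sending [X] to [i b + c *: X]. The isomorphism is [f q G]. *)
pose f c b e := i (pg e + pk e *: b) + (c * pk e) *: X.
have f_lin c b : linear (f c b).
  move=> z u v; rewrite /f /pg /pk linearP /= linearP !(linE i) /=.
  by lmod k.
have fE c b a z : f c b (i a + z *: X) = i (a + z *: b) + (c * z) *: X.
  by rewrite /f pg_iX pk_iX.
exists (mk_linear (f_lin q G)); split=> /= [|u v|a].
(* Solving [X' = G + q X] for [X] gives the inverse. *)
- exists (f q^-1 (- (q^-1 *: G))) => e;
    rewrite [in LHS](eE e) !fE [RHS]eE; apply: i_eq.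
  + by rewrite scalerN scalerA mulrAC divff // mul1r addrK.
  + by rewrite mulrA mulVf ?mul1r.
  + by lmod k.
  + by rewrite mulrA divff ?mul1r.
- have [a [c ->]] := iX_gen u; have [b [e ->]] := iX_gen v.
  rewrite sE !fE tE; apply: i_eq; last first.
    by rewrite !(la_eq, nu_eq, eq_al, scalE la', scalE nu'); ring.
  rewrite !(la_eq, nu_eq, (eqD _).1, (eqD _).2, eq_g0, eq_al, brgE,
    linE D', linE De').
  by lmod k.
- by rewrite {1}[val a]eq_i fE scale0r addr0 mulr0 -eq_i.
Qed.

(** On the line [V], an automorphism [v] is multiplication by a nonzero [q], and a linear [r] is
    determined by [G = r x]. The relation then reduces to its values at [x]. *)
Lemma LZ_equivP (s t : LZ V brg) d d' :
  LZ_table d s -> LZ_table d' t -> LZ_equiv s t <-> datum_equiv brg d d'.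
Proof.
case: s t => tl tr hl hr f cb s_leib [tl' tr' hl' hr' f' cb' t_leib].
case: d d' => la nu D De g0 al [la' nu' D' De' g0' al'].
case=> /= Tl Tr Tf Tc [/= Tl' Tr' Tf' Tc'].
have brgE := bilinearE brg_leibniz.1.
have [[Tl1 Tl2] [Tr1 Tr2]] := (all_and2 Tl, all_and2 Tr).
have [[Tl1' Tl2'] [Tr1' Tr2']] := (all_and2 Tl', all_and2 Tr').
have TE := (Tl1, Tl2, Tr1, Tr2, Tf, Tc).
have TE' := (Tl1', Tl2', Tr1', Tr2', Tf', Tc').
have mapsE := (bimapE tl, bimapE tr, bimapE hl, bimapE hr, bimapE f, bimapE cb).
have mapsE' :=
  (bimapE tl', bimapE tr', bimapE hl', bimapE hr', bimapE f', bimapE cb').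
have x0 : x != 0.
  apply/eqP => x0; have /x_free/eqP : 1 *: x = 0 *: x by rewrite x0 !scaler0.
  by rewrite oner_eq0.
split=> [[r [v [vi [vK viK eqs]]]]|[q [G [q0 la_eq nu_eq eqD [eq_al eq_g0]]]]].
  pose q := coord (v x); pose G := r x.
  have v_x : v x = q *: x by apply: coordE.
  have q0 : q != 0.
    apply: contraNneq x0 => q0; apply/eqP; apply: (can_inj vK).
    by rewrite v_x q0 scale0r linear0.
  have vi_x c : vi (c *: x) = (c / q) *: x.
    by apply: (can_inj vK); rewrite viK lin_scale v_x scalerA divfK.
  exists q, G; have {}eqs a := eqs a x x.
  have la_eq : la =1 la'.
    move=> a; have [[+ _] _ _ _ _] := eqs a.
    rewrite TE v_x mapsE' TE' scalerA vi_x.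
    by move/x_free ->; rewrite mulrAC divff ?mul1r.
  have nu_eq : nu =1 nu'.
    move=> a; have [[_ +] _ _ _ _] := eqs a.
    rewrite TE v_x mapsE' TE' scalerA vi_x.
    by move/x_free ->; rewrite mulrAC divff ?mul1r.
  (* The conditions on the curly bracket and on [f] do not involve the element of [g], so any
     instance gives them. *)
  have [_ _ _] := eqs 0.
  rewrite v_x !(mapsE', TE', TE) -/G !scalerA -!scalerDl.
  rewrite vi_x lin_scale -/G => /x_free eq_al; rewrite -eq_al => eq_g0.
  have {}eq_al : al = q * al' + la' G + nu' G by rewrite eq_al; field.
  split=> // [a|]; last first.
    by split=> //; rewrite eq_g0; lmod k.
  have [_ + + _ _] := eqs a.
  rewrite v_x !(mapsE', TE', TE) !scalerA !vi_x !(lin_scale r) -/G.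
  by rewrite !(mulrAC _ _ q^-1) !divff // !mul1r => -> ->; split; lmod k.
have r_lin : linear (fun y => coord y *: G).
  by move=> c y z /=; rewrite !(scalE coord); lmod k.
have v_lin : linear (fun y : V => q *: y) by move=> c y z; lmod k.
exists (mk_linear r_lin), (mk_linear v_lin), (fun y => q^-1 *: y).
split=> [y|y|a y z] /=; first by rewrite scalerA mulVf ?scale1r.
  by rewrite scalerA divff ?scale1r.
(* Every vector is a multiple of [x], so all conditions become equations on the datum. *)
have [[c ->] [e ->]] : (exists c, y = c *: x) /\ (exists e, z = e *: x).
  by split; [exists (coord y) | exists (coord z)].
have coordx : coord x = 1 by rewrite -[x]scale1r coordZ.
rewrite !(mapsE, mapsE', TE', TE, scalE coord, brgE, linE D', linE De',
  scalE la', coordx) !(la_eq, nu_eq, (eqD _).1, (eqD _).2, eq_g0, eq_al).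
by split; [split|..]; lmod k.
Qed.
End Extensions.

(** * The two kinds of flag datums among all data *)

Section Flags.
Variables (k : fieldType) (g : lmodType k) (brg : g -> g -> g).

Definition datum1 (f : flag1 brg) : datum g :=
  Datum (f1_lambda f) \0 (f1_D f) (f1_Delta f) (f1_g0 f) (f1_alpha f).

Definition datum2 (f : flag2 brg) : datum g :=
  Datum (\- f2_nu f) (f2_nu f) (f2_D f) (f2_Delta f) (f2_g0 f) 0.

Lemma datum1_ok f : datum_ok brg (datum1 f).
Proof.
case: f => g0 al la D De F1a F1b F1c F2a F2b F2c F3 F4 F5 F6 F7.
rewrite /datum1 /=; split=> [a b|a b|a b|a|]; last split=> [a|a|].
- by split; [apply: (eq_of_sub (esym (F6 a b))); lmod k | ring].
- split; last by ring.
  (* F3 expresses [[a, [b, x] + [x, b]] = 0]; adding the derivation rule F6 recovers the identity on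
     [(a, x, b)]. *)
  by apply: (eq_of_sub (congr2 +%R (F3 a b) (F6 a b))); lmod k.
- split; last by rewrite F1a; ring.
  by apply: (eq_of_sub (F7 a b)); lmod k.
- by split; [apply: (eq_of_sub (F2c a)); lmod k | ring].
- split; last by rewrite F1c; ring.
  by apply: (eq_of_sub (congr2 +%R (F4 a) (esym (F5 a)))); lmod k.
- split; first by apply: (eq_of_sub (F5 a)); lmod k.
  (* Viewing [k] as a module over itself lets [eq_of_sub] treat scalar equations too. *)
  by apply: (@eq_of_sub _ k^o _ _ _ _ (F1b a)); rewrite /=; ring.
- by rewrite F2a F2b; split; [lmod k | ring].
Qed.

Lemma datum2_ok f : datum_ok brg (datum2 f).
Proof.
case: f => g0 nu D De nu0 G1a G1b G1c G1d G2a G2b G3a G3b G4 G5.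
rewrite /datum2 /=; split=> [a b|a b|a b|a|]; last split=> [a|a|].
- split; last by rewrite G1a; ring.
  by apply: (eq_of_sub (esym (G4 a b))); lmod k.
- split; last by rewrite G1a; ring.
  by apply: (eq_of_sub (congr2 +%R (G2a a b) (G4 a b))); lmod k.
- split; last by rewrite G1a; ring.
  by apply: (eq_of_sub (G5 a b)); lmod k.
- by rewrite G1b; split; [lmod k | ring].
- split.
    by apply: (eq_of_sub (congr2 +%R (G3a a) (esym (G3b a)))); lmod k.
  by apply: (@eq_of_sub _ k^o _ _ _ _ (esym (G2b a))); rewrite /=; ring.
- by split; [apply: (eq_of_sub (G3b a)); lmod k | ring].
- by rewrite G1c G1d; split; [lmod k | ring].
Qed.

(** The cases are split on whether [nu] vanishes. In each, the flag axioms are linear combinations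
    of the generator equations. *)
Lemma flag_of_datum d : datum_ok brg d ->
  (exists f : flag1 brg, [/\ f1_lambda f = d_la d, d_nu d =1 \0, f1_D f = d_D d,
     f1_Delta f = d_De d & f1_g0 f = d_g0 d /\ f1_alpha f = d_al d]) \/
  (exists f : flag2 brg, [/\ d_la d =1 \- f2_nu f, f2_nu f = d_nu d,
     f2_D f = d_D d, f2_Delta f = d_De d & f2_g0 f = d_g0 d /\ d_al d = 0]).
Proof.
case: d => la nu D De g0 al /= [C1 C2 C3 C4 [C5 C6 [C7 C7k]]].
have nu_brg a b : nu (brg a b) = 0.
  by apply: (@eq_of_sub _ k^o _ _ _ _ (C2 a b).2); rewrite /=; ring.
have [[a0 nu_a0]|nu0] := pselect (exists a, nu a != 0); [right|left].
- have al0 : al = 0 by apply: (mulIf nu_a0); rewrite (C4 a0).2 mul0r.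
  (* The [x]-component on [(a0, a, x)] reads [nu a * nu a0 = - nu a0 * la a], and [nu a0]
     cancels. *)
  have laE a : la a = - nu a.
    apply: (mulfI nu_a0); have := (C1 a0 a).2; rewrite nu_brg sub0r => e.
    by rewrite mulrN [in RHS]mulrC e opprK.
  subst al.
  have p1 a : brg a g0 = 0 by have := (C4 a).1; rewrite scale0r addr0.
  have p2 : D g0 = 0 by move: C7; rewrite scale0r addr0.
  have p3 : nu g0 = 0 by apply: oppr_inj; rewrite -laE oppr0 -C7k; ring.
  have p4 a b : brg a (De b) + brg a (D b) = 0.
    (* The right sides on [(a, b, x)] and [(a, x, b)] are opposite, so the sum keeps only [[a,
       [b, x] + [x, b]]]. *)
    apply: (eq_of_sub (congr2 +%R (C1 a b).1 (C2 a b).1)).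
    by rewrite laE; lmod k.
  have p5 a : nu (D a) + nu (De a) = 0.
    apply: (@eq_of_sub _ k^o _ _ _ _ (esym (C5 a).2)).
    by rewrite /= !laE; ring.
  have p6 a : D (D a) + D (De a) = 0.
    apply: (eq_of_sub (congr2 +%R (C5 a).1 (C6 a).1)).
    by rewrite laE; lmod k.
  have p7 a : D (D a) + De (D a) = brg g0 a + (2%:R * nu a) *: g0.
    by apply: (eq_of_sub (C6 a).1); rewrite laE; lmod k.
  have p8 a b : De (brg a b)
      = brg (De a) b + brg a (De b) + nu b *: De a + nu a *: D b.
    by apply: (eq_of_sub (esym (C1 a b).1)); lmod k.
  have p9 a b : D (brg a b)
      = brg (D a) b - brg (D b) a - nu a *: D b + nu b *: D a.
    by apply: (eq_of_sub (C3 a b).1); rewrite !laE; lmod k.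
  exists (Flag2 (ex_intro _ a0 nu_a0) nu_brg p1 p2 p3 p4 p5 p6 p7 p8 p9).
  by split.
- have {}nu0 a : nu a = 0.
    by apply/eqP; apply: contrapT => /negP nu_a; apply: nu0; exists a.
  have p1 a b : la (brg a b) = 0 by rewrite (C3 a b).2; ring.
  have p2 a : la (D a) + al * la a = 0.
    by apply: (@eq_of_sub _ k^o _ _ _ _ (C6 a).2); rewrite /= nu0; ring.
  have p3 a : la (De a) = 0.
    by apply: (@eq_of_sub _ k^o _ _ _ _ (C5 a).2); rewrite /= !nu0; ring.
  have p4 : D g0 = - (al *: g0) by apply: (eq_of_sub C7); lmod k.
  have p5 : la g0 = - al ^+ 2.
    by apply: (@eq_of_sub _ k^o _ _ _ _ C7k); rewrite /=; ring.
  have p6 a : al *: De a = - brg a g0.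
    by apply: (eq_of_sub (C4 a).1); lmod k.
  have p7 a b : brg a (De b) + brg a (D b) = - (la b *: De a).
    apply: (eq_of_sub (congr2 +%R (C1 a b).1 (C2 a b).1)).
    by rewrite !nu0; lmod k.
  have p8 a : D (D a) + D (De a) = - (la a *: g0).
    apply: (eq_of_sub (congr2 +%R (C5 a).1 (C6 a).1)).
    by rewrite nu0; lmod k.
  have p9 a : D (D a) + De (D a)
      = al *: D a + brg g0 a - (2%:R * la a) *: g0.
    by apply: (eq_of_sub (C6 a).1); lmod k.
  have p10 a b : De (brg a b) = brg (De a) b + brg a (De b).
    by apply: (eq_of_sub (esym (C1 a b).1)); rewrite !nu0; lmod k.
  have p11 a b : D (brg a b)
      = brg (D a) b - brg (D b) a + la a *: D b - la b *: D a.
    by apply: (eq_of_sub (C3 a b).1); lmod k.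
  by exists (Flag1 p1 p2 p3 p4 p5 p6 p7 p8 p9 p10 p11); split.
Qed.

(** Substituting [al = q * al' + la' G] turns [al *: G] into the last two terms of the formula for
    [g0]. *)
Lemma flag1_equivP (e f : flag1 brg) :
  flag1_equiv brg e f <-> datum_equiv brg (datum1 e) (datum1 f).
Proof.
case: e f => g0 al la D De ? ? ? ? ? ? ? ? ? ? ?.
case=> g0' al' la' D' De' ? ? ? ? ? ? ? ? ? ? ?.
rewrite /datum1 /=; split=> [[la_eq [q [G [q0 eqs]]]]|
    [q [G [q0 la_eq _ eqD [eq_al eq_g0]]]]].
  have [eq_g0 eq_al _ _] := eqs 0; exists q, G.
  split=> // [a|]; last by rewrite eq_g0 eq_al; split; [ring | lmod k].
  by have [_ _ -> ->] := eqs a; split; lmod k.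
split=> //; exists q, G; split=> // a; have [-> ->] := eqD a.
by rewrite eq_g0 eq_al; split; [lmod k|ring|lmod k|lmod k].
Qed.

(** With [la' = - nu'] the terms [la' G + nu' G] cancel, so the equation for [al] is trivial and
    [al *: G] drops out. *)
Lemma flag2_equivP (e f : flag2 brg) :
  flag2_equiv brg e f <-> datum_equiv brg (datum2 e) (datum2 f).
Proof.
case: e f => g0 nu D De ? ? ? ? ? ? ? ? ? ? ?.
case=> g0' nu' D' De' ? ? ? ? ? ? ? ? ? ? ?.
rewrite /datum2 /=; split=> [[nu_eq [q [G [q0 eqs]]]]|
    [q [G [q0 _ nu_eq eqD [eq_al eq_g0]]]]].
  have [eq_g0 _ _] := eqs 0; exists q, G.
  split=> // [a|a|] /=; first by rewrite nu_eq.
    by have [_ -> ->] := eqs a; split; lmod k.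
  by rewrite eq_g0; split; [ring | lmod k].
split=> //; exists q, G; split=> // a; have [-> ->] := eqD a.
by rewrite eq_g0; split; lmod k.
Qed.

(** Equivalence preserves [nu], which is zero for the first kind and nonzero for the second. *)
Lemma datum_equiv12 (e : flag1 brg) (f : flag2 brg) :
  ~ datum_equiv brg (datum1 e) (datum2 f).
Proof.
case: f => g0 nu D De [a nu_a] ? ? ? ? ? ? ? ? ? ?.
case=> q [G [_ _ /(_ a) /= nu0 _ _]].
by rewrite -nu0 eqxx in nu_a.
Qed.

End Flags.

(** * Quotients *)

Section Quotients.
Variables (A B : Type) (R : A -> A -> Prop) (R' : B -> B -> Prop).

Lemma inj_surj_bij (f : A -> B) :
  injective f -> (forall b, exists a, f a = b) -> bijective f.
Proof.
move=> f_inj f_surj; pose h b := sval (cid (f_surj b)).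
have hK : cancel h f by move=> b; apply: svalP (cid (f_surj b)).
by exists h => // a; apply: f_inj; rewrite hK.
Qed.

(** Transfers the equivalence axioms from [ext_equiv], where they come from composing isomorphisms,
    to the relations given by formulas. *)
Lemma pullback_equivalence (f : A -> B) :
  RelationClasses.Equivalence R' -> (forall a b, R a b <-> R' (f a) (f b)) ->
  RelationClasses.Equivalence R.
Proof.
case=> R'_refl R'_sym R'_trans RE; split=> [a|a b|a b c].
- exact/RE.
- by move=> /RE/R'_sym/RE.
- by move=> /RE R'ab /RE R'bc; apply/RE; apply: R'_trans R'bc.
Qed.

Lemma cls_surj (C : quotient R) : exists a, C = cls R a.
Proof. by case: C => C [a defC]; exists a; apply: eq_exist. Qed.

Lemma eq_cls a b : RelationClasses.Equivalence R -> cls R a = cls R b <-> R a b.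
Proof.
case=> R_refl R_sym R_trans; split=> [/(congr1 sval)/= eq_ab|Rab].
  by have : [set u | R a u]%classic b by rewrite eq_ab; apply: R_refl.
apply: eq_exist; apply/seteqP; split=> c /= Rc.
  exact: R_trans (R_sym _ _ Rab) Rc.
exact: R_trans Rab Rc.
Qed.

End Quotients.

(** One direction of the equivalence of relations makes the map independent of the chosen
    representative, the other makes it injective. *)
Lemma quotient_map (A B : Type) (R : A -> A -> Prop) (R' : B -> B -> Prop)
    (f : A -> B) :
  RelationClasses.Equivalence R' -> (forall a b, R a b <-> R' (f a) (f b)) ->
  exists2 F : quotient R -> quotient R',
    forall a, F (cls R a) = cls R' (f a) & injective F.
Proof.
move=> R'_eqv RE; have R_eqv := pullback_equivalence R'_eqv RE.
pose F C := cls R' (f (sval (cid (@cls_surj _ R C)))).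
have FE a : F (cls R a) = cls R' (f a).
  rewrite /F; case: cid => b /= /(eq_cls _ _ R_eqv) Rab.
  by apply/(eq_cls _ _ R'_eqv); apply/RE;
    apply: RelationClasses.Equivalence_Symmetric.
exists F => // C1 C2; have [a ->] := cls_surj C1; have [b ->] := cls_surj C2.
by rewrite !FE => /(eq_cls _ _ R'_eqv)/RE/(eq_cls _ _ R_eqv).
Qed.

(** * The three quotients and the bijections between them *)

Lemma ext_equiv_equivalence (k : fieldType) (E : lmodType k) (S : {pred E})
    (g : subLmodType S) (brg : g -> g -> g) :
  RelationClasses.Equivalence (ext_equiv brg).
Proof.
split=> [s|s t [phi [[psi phiK psiK] phiM phi_val]]|
    s t u [phi [phi_bij phiM phi_val]] [psi [psi_bij psiM psi_val]]].
- by exists idfun; split=> //; exists id.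
- have psi_lin : linear psi.
    by move=> c u v; apply: (can_inj phiK); rewrite linearP !psiK.
  exists (mk_linear psi_lin); split=> [|a b|a] /=; first by exists phi.
    by apply: (can_inj phiK); rewrite phiM !psiK.
  by apply: (can_inj phiK); rewrite psiK phi_val.
- exists (psi \o phi); split=> [|a b|a] /=; first exact: bij_comp.
    by rewrite phiM psiM.
  by rewrite phi_val psi_val.
Qed.

Theorem theorem3p6 (k : fieldType) (E : lmodType k)
    (S : {pred E}) (g : subLmodType S) (brg : g -> g -> g)
    (g_leibniz : leibniz_bracket brg) (g_codim1 : codim1 S)
    (T : {pred E}) (V : subLmodType T) (V_compl : complement S T)
    (x : V) (x_basis : basis1 x) :
  [/\ RelationClasses.Equivalence (flag1_equiv brg),
      RelationClasses.Equivalence (flag2_equiv brg)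
    & exists (Phi : HL2 V brg -> ExtdL brg)
             (Psi : quotient (flag1_equiv brg)
                    + quotient (flag2_equiv brg) -> HL2 V brg),
      [/\ bijective Phi,
          bijective Psi,
          forall d : flag1 brg, exists B (s : ext_struct brg),
            [/\ is_g1 x d B, viewed_on B s
              & Phi (Psi (inl (cls (flag1_equiv brg) d)))
                = cls (ext_equiv brg) s]
        & forall d : flag2 brg, exists B (s : ext_struct brg),
            [/\ is_g2 x d B, viewed_on B s
              & Phi (Psi (inr (cls (flag2_equiv brg) d)))
                = cls (ext_equiv brg) s]]].
Proof.
have [coord coordE] := basis1_coord x_basis.
have x_free := basis1_free x_basis.
have [P [PK decompK]] := @decomp_inverse k E S T g V V_compl.
pose extP := ext_equivP g_leibniz PK decompK coordE x_free.
pose LZP := LZ_equivP g_leibniz coordE x_free.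
pose F := LZ_ext decompK : LZ V brg -> ext_struct brg.
have F_table d s : LZ_table x d s <-> bracket_table brg \val (val x) d (F s).
  exact: LZ_ext_table.
have LZ_ok (s : LZ V brg) : exists2 d, LZ_table x d s & datum_ok brg d.
  have [d tab_d ok_d] := ext_table PK decompK coordE x_free (F s).
  by exists d => //; apply/F_table.
have ext_eqv : RelationClasses.Equivalence (ext_equiv brg).
  exact: ext_equiv_equivalence.
(* A structure and its extension share the same datum, and both relations amount to [datum_equiv] on
   it. *)
have F_equiv (s t : LZ V brg) : LZ_equiv s t <-> ext_equiv brg (F s) (F t).
  have [[d s_d _] [d' t_d' _]] := (LZ_ok s, LZ_ok t).
  rewrite (LZP _ _ _ _ s_d t_d').
  by rewrite (extP _ _ _ _ (iffLR (F_table _ _) s_d)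
    (iffLR (F_table _ _) t_d')).
have LZ_eqv := pullback_equivalence ext_eqv F_equiv.
have [Phi PhiE Phi_inj] := quotient_map ext_eqv F_equiv.
(* An extending structure with the given datum is chosen for each flag datum. *)
have H1P (f : flag1 brg) : {s : LZ V brg | LZ_table x (datum1 f) s}.
  apply: cid; apply: LZ_of_datum => //; exact: datum1_ok.
have H2P (f : flag2 brg) : {s : LZ V brg | LZ_table x (datum2 f) s}.
  apply: cid; apply: LZ_of_datum => //; exact: datum2_ok.
pose H1 f := sval (H1P f); pose H2 f := sval (H2P f).
have H1_equiv e f : flag1_equiv brg e f <-> LZ_equiv (H1 e) (H1 f).
  by rewrite flag1_equivP (LZP _ _ _ _ (svalP (H1P e)) (svalP (H1P f))).
have H2_equiv e f : flag2_equiv brg e f <-> LZ_equiv (H2 e) (H2 f).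
  by rewrite flag2_equivP (LZP _ _ _ _ (svalP (H2P e)) (svalP (H2P f))).
have H12 e f : ~ LZ_equiv (H1 e) (H2 f).
  rewrite (LZP _ _ _ _ (svalP (H1P e)) (svalP (H2P f))).
  exact: datum_equiv12.
have H_surj (s : LZ V brg) :
    (exists f, LZ_equiv (H1 f) s) \/ (exists f, LZ_equiv (H2 f) s).
  have [d [Tl Tr Tf Tc] /flag_of_datum[]] := LZ_ok s.
  - case=> f [la_eq nu0 D_eq De_eq [g0_eq al_eq]]; left; exists f.
    have s_f : LZ_table x (datum1 f) s.
      rewrite /LZ_table /= la_eq D_eq De_eq g0_eq al_eq; split=> // a.
      by rewrite (Tl a).1 (Tl a).2 nu0.
    by rewrite (LZP _ _ _ _ (svalP (H1P f)) s_f); apply: datum_equiv_refl.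
  - case=> f [la_eq nu_eq D_eq De_eq [g0_eq al0]]; right; exists f.
    have s_f : LZ_table x (datum2 f) s.
      rewrite /LZ_table /= -al0 D_eq De_eq g0_eq; split=> // a.
      by rewrite (Tl a).1 (Tl a).2 la_eq nu_eq.
    by rewrite (LZP _ _ _ _ (svalP (H2P f)) s_f); apply: datum_equiv_refl.
have [Psi1 Psi1E Psi1_inj] := quotient_map LZ_eqv H1_equiv.
have [Psi2 Psi2E Psi2_inj] := quotient_map LZ_eqv H2_equiv.
split; [exact: pullback_equivalence LZ_eqv H1_equiv |
        exact: pullback_equivalence LZ_eqv H2_equiv |].
have cross C1 C2 : Psi1 C1 <> Psi2 C2.
  have [[e ->] [f ->]] := (cls_surj C1, cls_surj C2).
  by rewrite Psi1E Psi2E => /(eq_cls _ _ LZ_eqv)/H12.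
exists Phi, (fun C => match C with inl C1 => Psi1 C1 | inr C2 => Psi2 C2 end).
split.
(* For surjectivity, rebuild an extending structure from the datum of [t]: its extension has the
   same datum, hence is equivalent to [t]. *)
- apply: inj_surj_bij => // C; have [t ->] := cls_surj C.
  have [d tab_d ok_d] := ext_table PK decompK coordE x_free t.
  have [s s_d] := LZ_of_datum g_leibniz coordE x_free ok_d.
  exists (cls _ s); rewrite PhiE; apply/(eq_cls _ _ ext_eqv).
  apply/(extP _ _ _ _ (iffLR (F_table _ _) s_d) tab_d).
  exact: datum_equiv_refl.
- apply: inj_surj_bij => [[C1|C2] [C1'|C2'] //|C].
  + by move/Psi1_inj->.
  + by move/cross.
  + by move/esym/cross.
  + by move/Psi2_inj->.
  have [s ->] := cls_surj C; have [[f f_s]|[f f_s]] := H_surj s.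
    by exists (inl (cls _ f)); rewrite Psi1E; apply/(eq_cls _ _ LZ_eqv).
  by exists (inr (cls _ f)); rewrite Psi2E; apply/(eq_cls _ _ LZ_eqv).
(* The unified bracket of the chosen structure is itself the bracket of the flag datum, as its
   values on generators show. *)
- move=> f; exists (LZ_bracket (H1 f)), (F (H1 f)).
  split; last by rewrite Psi1E PhiE.
    have [B_bil Baa Bax Bxx Bxa] := LZ_bracket_gens g_leibniz (svalP (H1P f)).
    by split=> // a; rewrite Bax scale0r.
  exact: LZ_ext_viewed.
- move=> f; exists (LZ_bracket (H2 f)), (F (H2 f)).
  split; last by rewrite Psi2E PhiE.
    have [B_bil Baa Bax Bxx Bxa] := LZ_bracket_gens g_leibniz (svalP (H2P f)).
    by split=> //; [rewrite Bxx scale0r | move=> a; rewrite Bxa scaleNr].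
  exact: LZ_ext_viewed.
Qed.
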